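(* Let $f:\mathbb{R}^d\to[0,\infty)$ be a proper log-concave function. If there is a Gaussian density that is pointwise less than or equal to $f$, then there exists a Gaussian density of maximal integral among all Gaussian densities that are pointwise less than or equal to $f$. Moreover, all Gaussian densities of maximal integral that are pointwise less than or equal to $f$ are translates of each other.
   Context: A function $f:\mathbb{R}^d\to[0,\infty)$ is log-concave if $f=e^{-\psi}$ for some convex $\psi:\mathbb{R}^d\to\mathbb{R}\cup\{\infty\}$; it is proper log-concave if moreover it is upper semi-continuous and has finite positive integral. In this statement a ''Gaussian density'' on $\mathbb{R}^d$ is any function (not necessarily of integral 1) of the form $x\mapsto\alpha e^{-\langle A^{-1}(x-a),A^{-1}(x-a)\rangle}$ with $A\in\mathbb{R}^{d\times d}$ positive definite, $\alpha>0$ and $a\in\mathbb{R}^d$. *)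

(* Defs.v *)
From HB Require Import structures.
From mathcomp Require Import all_boot all_order all_algebra.
From mathcomp Require Import all_classical all_reals all_analysis.

Set Implicit Arguments.
Unset Strict Implicit.
Unset Printing Implicit Defensive.
Import Order.TTheory GRing.Theory Num.Theory.
Import numFieldNormedType.Exports.

Local Open Scope classical_set_scope.
Local Open Scope ring_scope.

(* Points of R^d are column vectors 'cV[R]_d. As for n.-tuple in the library,
   they carry the product sigma-algebra, generated by the coordinates; over a
   realType this is the Borel sigma-algebra of R^d. *)
Definition cV_display : measure_display -> measure_display.
Proof. exact. Qed.

Definition cV_coord (T : Type) (n : nat) (i : 'I_n) (x : 'cV[T]_n) : T := x i 0.

Section measurable_cV.
Context {d : measure_display} {T : measurableType d}.
Variable n : nat.

Let cV_set0 : g_sigma_preimage (@cV_coord T n) set0.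
Proof. exact: sigma_algebra0. Qed.

Let cV_setC A : g_sigma_preimage (@cV_coord T n) A ->
  g_sigma_preimage (@cV_coord T n) (~` A).
Proof. exact: sigma_algebraC. Qed.

Let cV_bigcup (F : (set 'cV[T]_n)^nat) :
  (forall i, g_sigma_preimage (@cV_coord T n) (F i)) ->
  g_sigma_preimage (@cV_coord T n) (\bigcup_i (F i)).
Proof. exact: sigma_algebra_bigcup. Qed.

HB.instance Definition _ := @isMeasurable.Build (cV_display d)
  'cV[T]_n (g_sigma_preimage (@cV_coord T n)) cV_set0 cV_setC cV_bigcup.

End measurable_cV.

Section measurable_cV_theory.
Context {d1 d2 : measure_display}.
Context {T1 : measurableType d1} {T2 : measurableType d2}.

Lemma measurable_cV_coord n (i : 'I_n) :
  measurable_fun [set: 'cV[T2]_n] (@cV_coord T2 n i).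
Proof.
move=> _ Y mY; rewrite setTI; apply: sub_sigma_algebra => /=.
rewrite -bigcup_seq/=; exists i => /=; first by rewrite mem_index_enum.
by exists Y => //; rewrite setTI.
Qed.

Lemma measurable_fun_cV n (f : T1 -> 'cV[T2]_n) :
  (forall i, measurable_fun [set: T1] (cV_coord i \o f)) ->
  measurable_fun [set: T1] f.
Proof.
move=> mf _ A mA.
have : g_sigma_preimage (fun i => cV_coord i \o f) `<=` measurable.
  apply: smallest_sub; first exact: sigma_algebra_measurable.
  rewrite -bigcup_seq; apply: bigcup_sub => i _ B [C mC <-].
  exact: mf.
by rewrite g_sigma_preimage_comp; apply; exists A.
Qed.

End measurable_cV_theory.

Section lebesgue_cV.
Context {R : realType}.

Definition cV_cons (n : nat) (p : R * 'cV[R]_n) : 'cV[R]_n.+1 :=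
  col_mx (const_mx p.1 : 'cV[R]_1) p.2.

Definition cV_uncons (n : nat) (x : 'cV[R]_n.+1) : R * 'cV[R]_n :=
  (x ord0 0, \col_i x (lift ord0 i) 0).

Lemma cV_consK n : cancel (@cV_cons n) (@cV_uncons n).
Proof.
case=> a v; congr pair; rewrite /cV_cons /=.
  have -> : ord0 = lshift n ord0 :> 'I_(1 + n) by exact/val_inj.
  by rewrite (@col_mxEu R 1 n 1) mxE.
apply/matrixP => i j; rewrite mxE ord1.
have -> : lift ord0 i = rshift 1 i :> 'I_(1 + n) by exact/val_inj.
by rewrite (@col_mxEd R 1 n 1).
Qed.

Lemma measurable_cV_cons n :
  measurable_fun [set: measurableTypeR R * 'cV[R]_n] (@cV_cons n).
Proof.
apply: measurable_fun_cV => i.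
case: (unliftP ord0 i) => [j|] ->.
  have -> : cV_coord (lift ord0 j) \o @cV_cons n = cV_coord j \o snd.
    apply/funext => p /=; have := congr1 (fun q : R * 'cV[R]_n => q.2 j 0) (cV_consK p).
    by rewrite /cV_uncons/= mxE.
  exact: measurableT_comp (measurable_cV_coord j) measurable_snd.
have -> : cV_coord ord0 \o @cV_cons n = fst.
  by apply/funext => p; exact: (congr1 (@fst _ _) (cV_consK p)).
exact: measurable_fst.
Qed.

Lemma measurable_cV_uncons n : measurable_fun [set: 'cV[R]_n.+1]
  (@cV_uncons n : _ -> measurableTypeR R * 'cV[R]_n).
Proof.
apply/measurable_fun_pairP; split.
  exact: (measurable_cV_coord (T2 := R) ord0).
apply: measurable_fun_cV => j.
have -> : cV_coord j \o (snd \o @cV_uncons n) = cV_coord (lift ord0 j).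
  by apply/funext => x; rewrite /cV_coord /= mxE.
exact: (measurable_cV_coord (T2 := R) (lift ord0 j)).
Qed.

Section cons_measure.
Variables (n : nat) (mu : {sigma_finite_measure set 'cV[R]_n -> \bar R}).

Definition cons_measure : set 'cV[R]_n.+1 -> \bar R :=
  pushforward (@lebesgue_measure R \x mu)%E (@cV_cons n).

Let cons_measure0 : cons_measure set0 = 0%E.
Proof. by rewrite /cons_measure /pushforward preimage_set0 measure0. Qed.

Let cons_measure_ge0 A : (0 <= cons_measure A)%E.
Proof. by rewrite /cons_measure /pushforward; exact: measure_ge0. Qed.

Let cons_measure_sigma_additive : semi_sigma_additive cons_measure.
Proof.
move=> F mF tF mUF; rewrite /cons_measure /pushforward preimage_bigcup.
have mpre i : measurable (@cV_cons n @^-1` F i).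
  by rewrite -[X in measurable X]setTI; exact: measurable_cV_cons.
apply: measure_semi_sigma_additive => //.
- apply/trivIsetP => /= i j _ _ ij; rewrite -preimage_setI.
  by move/trivIsetP : tF => /(_ _ _ _ _ ij) ->//; rewrite preimage_set0.
- exact: bigcupT_measurable.
Qed.

HB.instance Definition _ := isMeasure.Build _ _ _ cons_measure
  cons_measure0 cons_measure_ge0 cons_measure_sigma_additive.

Let cons_measure_sigma_finite : sigma_finite setT cons_measure.
Proof.
have /sigma_finiteP[F [TF ndF Foo]] := sigma_finiteT (@lebesgue_measure R).
have /sigma_finiteP[G [TG ndG Goo]] := sigma_finiteT mu.
have preS (A : set (measurableTypeR R * 'cV[R]_n)) :
    @cV_cons n @^-1` (@cV_uncons n @^-1` A) = A.
  by rewrite -comp_preimage (_ : _ \o _ = id)//; apply/funext/cV_consK.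
exists (fun k => @cV_uncons n @^-1` (F k `*` G k)).
  rewrite -preimage_bigcup (_ : \bigcup_k _ = setT) ?preimage_setT//.
  rewrite predeqE => -[x y]; split=> // _.
  have [k _ Fkx] : (\bigcup_k F k) x by rewrite -TF.
  have [l _ Gly] : (\bigcup_k G k) y by rewrite -TG.
  exists (maxn k l) => //; split.
    by move: Fkx; exact/subsetPset/ndF/leq_maxl.
  by move: Gly; exact/subsetPset/ndG/leq_maxr.
move=> k; have [mF Fkoo] := Foo k; have [mG Gkoo] := Goo k.
have mFG : measurable (F k `*` G k) by exact: measurableX.
split; first by rewrite -[X in measurable X]setTI; exact: measurable_cV_uncons.
rewrite /cons_measure /pushforward preS.
by rewrite product_measure1E// lte_mul_pinfty// ge0_fin_numE.
Qed.

HB.instance Definition _ := Measure_isSigmaFinite.Build _ _ _ cons_measure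
  cons_measure_sigma_finite.

End cons_measure.

(* Lebesgue measure on R^n: the n-fold product of the Lebesgue measure on R. *)
Fixpoint lebesgue_cV (n : nat) : {sigma_finite_measure set 'cV[R]_n -> \bar R} :=
  match n return {sigma_finite_measure set 'cV[R]_n -> \bar R} with
  | 0 => \d_ (0 : 'cV[R]_0)
  | n'.+1 => cons_measure (lebesgue_cV n')
  end.

End lebesgue_cV.

Section log_concave.
Context {R : realType} {d : nat}.
Implicit Types f g h : 'cV[R]_d -> R.

(* No value -oo is allowed, so both sides below avoid oo - oo; the endpoints
   are harmless because 0 * +oo = 0. *)
Definition convex_ereal (psi : 'cV[R]_d -> \bar R) : Prop :=
  (forall x, psi x != -oo%E) /\
  forall (x y : 'cV[R]_d) (t : R), 0 <= t <= 1 ->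
    (psi (t *: x + (1 - t) *: y)%R <= t%:E * psi x + (1 - t)%:E * psi y)%E.

(* f >= 0 follows, since expeR takes its values in [0, +oo]. *)
Definition log_concave f : Prop :=
  exists psi : 'cV[R]_d -> \bar R,
    convex_ereal psi /\ forall x, (f x)%:E = expeR (- psi x)%E.

Definition upper_semicontinuous f : Prop :=
  lower_semicontinuous (fun x => (- f x)%:E).

Definition integral_cV f : \bar R := (\int[lebesgue_cV d]_x (f x)%:E)%E.

Definition proper_log_concave f : Prop :=
  [/\ log_concave f, upper_semicontinuous f & (0 < integral_cV f < +oo)%E].

Definition dotv (u v : 'cV[R]_d) : R := \sum_i u i 0 * v i 0.

Definition posdefmx (A : 'M[R]_d) : Prop :=
  A^T = A /\ forall x : 'cV[R]_d, x != 0 -> 0 < dotv x (A *m x).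

Definition gaussian_density g : Prop :=
  exists (A : 'M[R]_d) (alpha : R) (a : 'cV[R]_d),
    [/\ posdefmx A, 0 < alpha & forall x,
      g x = alpha *
        expR (- dotv (invmx A *m (x - a)) (invmx A *m (x - a)))].

Definition gaussian_below f g : Prop :=
  gaussian_density g /\ forall x, g x <= f x.

Definition max_gaussian_below f g : Prop :=
  gaussian_below f g /\
  forall h, gaussian_below f h -> (integral_cV h <= integral_cV g)%E.

Definition translate_of g h : Prop :=
  exists v : 'cV[R]_d, forall x, h x = g (x - v).

End log_concave.

(* Main.v *)
Require Import Defs.
From mathcomp Require Import all_boot all_order all_algebra.
From mathcomp Require Import all_classical all_reals all_analysis.
From mathcomp Require Import measurable_realfun perm ring lra.

Set Implicit Arguments.
Unset Strict Implicit.
Unset Printing Implicit Defensive.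
Import Order.TTheory GRing.Theory Num.Theory.
Import numFieldNormedType.Exports.
Local Open Scope classical_set_scope.
Local Open Scope ring_scope.

(* The Gaussian [al * exp (- |A^-1 (x - a)|^2)] has integral [pi^(d/2) * al * det A],
   so one maximizes [al * det A]. Log-concavity of [f] makes the set of Gaussians
   below [f] stable under the midpoint operation
   [(A1, al1, a1), (A2, al2, a2) |-> ((A1 + A2) / 2, sqrt (al1 * al2), (a1 + a2) / 2)],
   and det A * det B <= det ((A + B) / 2)^2 with equality only for A = B. Two
   maximizers thus have the same matrix, hence the same height. For existence, the
   midpoint with a fixed Gaussian [g0 <= f] also bounds [A] and [al] as soon as
   [al * det A] is bounded below: a large diagonal entry of [A] would make the
   value of the midpoint exceed the integral of [f]. The center stays bounded
   because superlevel sets of [f] are bounded: a far away point would give, with a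
   ball around the center of [g0], many disjoint unit cubes on which [f] is bounded
   below. The parameters then range over a compact set. *)

(** * Schur complements and the midpoint determinant inequality *)

Section quadratic_form.
Context {R : realType}.

Lemma dotvE n (u v : 'cV[R]_n) : dotv u v = (u^T *m v) 0 0.
Proof. by rewrite mxE; apply: eq_bigr => i _; rewrite mxE. Qed.

Lemma dotv_ge0 n (u : 'cV[R]_n) : 0 <= dotv u u.
Proof. by apply: sumr_ge0 => i _; rewrite -expr2 sqr_ge0. Qed.

Lemma dotv_eq0 n (u : 'cV[R]_n) : dotv u u = 0 -> u = 0.
Proof.
move=> /psumr_eq0P u0; apply/matrixP => i j; rewrite ord1 mxE; apply/eqP.
rewrite -[_ == 0]orbb -mulf_eq0; apply/eqP/u0 => // k _.
by rewrite -expr2 sqr_ge0.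
Qed.

Definition qf n (Q : 'M[R]_n) (x : 'cV[R]_n) : R := dotv x (Q *m x).

Lemma qf_delta n (Q : 'M[R]_n) i : qf Q (delta_mx i 0) = Q i i.
Proof.
rewrite /qf -colE /dotv (bigD1 i)//= big1 => [|j ji].
  by rewrite !mxE !eqxx mul1r addr0.
by rewrite !mxE (negPf ji) mul0r.
Qed.

Lemma qf0 n (Q : 'M[R]_n) : qf Q 0 = 0.
Proof. by rewrite /qf dotvE mulmx0 mulmx0 mxE. Qed.

Lemma qfD n (P Q : 'M[R]_n) x : qf (P + Q) x = qf P x + qf Q x.
Proof. by rewrite /qf !dotvE mulmxDl mulmxDr mxE. Qed.

Lemma qfZ n c (Q : 'M[R]_n) x : qf (c *: Q) x = c * qf Q x.
Proof. by rewrite /qf !dotvE -scalemxAl -scalemxAr mxE. Qed.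

Lemma qf_gram n (Q : 'M[R]_n) x : dotv (Q *m x) (Q *m x) = qf (Q^T *m Q) x.
Proof. by rewrite /qf !dotvE trmx_mul !mulmxA. Qed.

Lemma posdefmx_qf n (Q : 'M[R]_n) x : posdefmx Q -> 0 <= qf Q x.
Proof.
move=> [_ Qpos]; have [->|x0] := eqVneq x 0; first by rewrite qf0.
exact/ltW/Qpos.
Qed.

Lemma delta_neq0 n (i : 'I_n) : delta_mx i 0 != 0 :> 'cV[R]_n.
Proof.
by apply/eqP => /matrixP/(_ i 0)/eqP; rewrite !mxE !eqxx oner_eq0.
Qed.

Lemma posdefmx_diag n (Q : 'M[R]_n) i : posdefmx Q -> 0 < Q i i.
Proof. by move=> [_ Qpos]; rewrite -qf_delta; apply: Qpos; exact: delta_neq0. Qed.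

Definition schur n (Q : 'M[R]_(1 + n)) : 'M[R]_n :=
  drsubmx Q - (Q 0 0)^-1 *: ((ursubmx Q)^T *m ursubmx Q).

(** When the pivot [Q 0 0] is positive, [- schur_row Q y] is the first coordinate [t] that minimizes
    the form of [Q] at [(t, y)]. *)
Definition schur_row n (Q : 'M[R]_(1 + n)) (y : 'cV[R]_n) : R :=
  (Q 0 0)^-1 * (ursubmx Q *m y) 0 0.

Lemma sym_blockE n (Q : 'M[R]_(1 + n)) : Q^T = Q ->
  Q = block_mx (Q 0 0)%:M (ursubmx Q) (ursubmx Q)^T (drsubmx Q).
Proof.
move=> Qs; rewrite -[LHS]submxK trmx_ursub Qs [ulsubmx Q]mx11_scalar.
by rewrite !mxE; congr (block_mx (Q _ _)%:M _ _ _); apply: val_inj.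
Qed.

Lemma sym_schur n (Q : 'M[R]_(1 + n)) : Q^T = Q -> (schur Q)^T = schur Q.
Proof.
move=> Qs; rewrite /schur linearB/= linearZ/= trmx_mul trmxK.
by rewrite trmx_drsub Qs.
Qed.

Lemma qf_schur n (Q : 'M[R]_(1 + n)) (t : R) y : Q^T = Q -> Q 0 0 != 0 ->
  qf Q (col_mx (const_mx t) y) =
  Q 0 0 * (t + schur_row Q y) ^+ 2 + qf (schur Q) y.
Proof.
move=> Qs q0; rewrite /qf !dotvE {1}(sym_blockE Qs).
have -> : const_mx t = t%:M :> 'M[R]_1.
  by apply/matrixP => i j; rewrite !ord1 !mxE.
rewrite mul_block_col tr_col_mx mul_row_col mxE /schur mulmxBl mulmxBr.
rewrite !mulmxDr -scalemxAl -scalemxAr -!mulmxA.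
have -> : y^T *m ((ursubmx Q)^T *m (ursubmx Q *m y)) =
   (ursubmx Q *m y)^T *m (ursubmx Q *m y) by rewrite trmx_mul mulmxA.
have -> : y^T *m ((ursubmx Q)^T *m t%:M) = (ursubmx Q *m y)^T *m t%:M.
  by rewrite trmx_mul mulmxA.
rewrite /schur_row [ursubmx Q *m y]mx11_scalar.
rewrite !tr_scalar_mx -!scalar_mxM !mxE !eqxx !mulr1n.
by field.
Qed.

(** Block elimination: [Q] is a unit lower triangular block matrix times an upper triangular one
    with diagonal blocks [Q 0 0] and [schur Q]. *)
Lemma det_schur n (Q : 'M[R]_(1 + n)) : Q^T = Q -> Q 0 0 != 0 ->
  \det Q = Q 0 0 * \det (schur Q).
Proof.
move=> Qs q0; rewrite {1}(sym_blockE Qs).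
have -> : block_mx (Q 0 0)%:M (ursubmx Q) (ursubmx Q)^T (drsubmx Q) =
  block_mx 1%:M 0 ((Q 0 0)^-1 *: (ursubmx Q)^T) 1%:M *m
  block_mx (Q 0 0)%:M (ursubmx Q) 0 (schur Q).
  rewrite mulmx_block !mul1mx !mul0mx !addr0 /schur -!scalemxAl.
  by rewrite mul_mx_scalar scalerA mulVf// scale1r addrC subrK.
by rewrite det_mulmx det_lblock det_ublock !det1 !mul1r det_scalar1.
Qed.

(** At the minimizing first coordinate the square in [qf_schur] vanishes, so the value of the Schur
    form at [y] is a value of the form of [Q]. *)
Lemma posdefmx_schur n (Q : 'M[R]_(1 + n)) : posdefmx Q -> posdefmx (schur Q).
Proof.
move=> Qpd; have q0 := posdefmx_diag 0 Qpd; have [Qs Qpos] := Qpd.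
split=> [|y y0]; first exact: sym_schur.
have := Qpos (col_mx (const_mx (- schur_row Q y)) y).
rewrite -/(qf _ _) qf_schur ?gt_eqF// addNr expr0n mulr0 add0r; apply.
by apply: contra_neq y0 => /(congr1 dsubmx); rewrite col_mxKd linear0.
Qed.

Lemma posdefmx_det n (Q : 'M[R]_n) : posdefmx Q -> 0 < \det Q.
Proof.
elim: n Q => [|n IH] Q Qpd; first by rewrite det_mx00.
have q0 := @posdefmx_diag (1 + n) Q 0 Qpd; have [Qs _] := Qpd.
rewrite (@det_schur n Q) ?gt_eqF// mulr_gt0//.
by apply: IH; exact: posdefmx_schur.
Qed.

Lemma posdefmx_unit n (Q : 'M[R]_n) : posdefmx Q -> Q \in unitmx.
Proof. by move=> /posdefmx_det Q0; rewrite unitmxE unitfE gt_eqF. Qed.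

(** On basis vectors [schur_row] gives the rest of the first row divided by the pivot. Once pivot
    and row agree, the Schur complement determines the lower right block. *)
Lemma schur_inj n (P Q : 'M[R]_(1 + n)) : P^T = P -> Q^T = Q ->
  Q 0 0 != 0 -> P 0 0 = Q 0 0 -> schur_row P =1 schur_row Q ->
  schur P = schur Q -> P = Q.
Proof.
move=> Ps Qs q0 PQ0 PQr PQs.
have PQu : ursubmx P = ursubmx Q.
  apply/matrixP => i j; have := PQr (delta_mx j 0).
  rewrite /schur_row PQ0 -!colE ![col _ _ _ _]mxE !ord1.
  by apply/mulfI; rewrite invr_eq0.
rewrite (sym_blockE Ps) (sym_blockE Qs) PQ0 PQu.
by move: PQs; rewrite /schur PQ0 PQu => /addIr ->.
Qed.

(* The hypothesis at the point [(t, y)] whose first coordinate [t] minimizes the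
   form of [M], completed to squares for all three forms. *)
Lemma schur_midpoint n (A B M : 'M[R]_(1 + n)) :
  posdefmx A -> posdefmx B -> M^T = M -> M 0 0 != 0 ->
  (forall x, qf A x + qf B x <= 2 * qf M x) ->
  forall y, A 0 0 * (schur_row A y - schur_row M y) ^+ 2 +
    B 0 0 * (schur_row B y - schur_row M y) ^+ 2 +
    qf (schur A) y + qf (schur B) y <= 2 * qf (schur M) y.
Proof.
move=> Apd Bpd Ms m0 le_M y.
have a0 := posdefmx_diag 0 Apd; have b0 := posdefmx_diag 0 Bpd.
have := le_M (col_mx (const_mx (- schur_row M y)) y).
have [As _] := Apd; have [Bs _] := Bpd.
rewrite !qf_schur ?(lt0r_neq0 a0) ?(lt0r_neq0 b0)//.
rewrite addNr expr0n/= mulr0 add0r; apply: le_trans.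
by rewrite le_eqVlt; apply/orP; left; apply/eqP; ring.
Qed.

Lemma schur_midpoint_le n (A B M : 'M[R]_(1 + n)) :
  posdefmx A -> posdefmx B -> M^T = M -> M 0 0 != 0 ->
  (forall x, qf A x + qf B x <= 2 * qf M x) ->
  forall y, qf (schur A) y + qf (schur B) y <= 2 * qf (schur M) y.
Proof.
move=> Apd Bpd Ms m0 le_M y; apply: le_trans (schur_midpoint Apd Bpd Ms m0 le_M y).
rewrite -addrA lerDr addr_ge0// mulr_ge0 ?sqr_ge0// ltW//; exact: posdefmx_diag.
Qed.

(** Induction on the size through Schur complements. The hypothesis is an inequality of forms, not
    [M = (A + B) / 2], because the Schur complement of a midpoint is in general not the midpoint of
    the Schur complements, while the inequality is inherited. The pivots contribute the
    arithmetic-geometric inequality. *)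
Lemma det_midpoint n (A B M : 'M[R]_n) :
  posdefmx A -> posdefmx B -> M^T = M ->
  (forall x, qf A x + qf B x <= 2 * qf M x) ->
  \det A * \det B <= \det M ^+ 2 /\
  (\det A * \det B = \det M ^+ 2 -> A = M /\ B = M).
Proof.
elim: n A B M => [|n IH] A B M Apd Bpd Ms le_M.
  by rewrite !det_mx00 mulr1 expr1n; split=> // _; rewrite !thinmx0.
have a0 := @posdefmx_diag (1 + n) A 0 Apd.
have b0 := @posdefmx_diag (1 + n) B 0 Bpd.
have abm : A 0 0 + B 0 0 <= 2 * M 0 0.
  by rewrite -!qf_delta; exact: le_M.
have m0 : 0 < M 0 0 by lra.
have [As _] := Apd; have [Bs _] := Bpd.
have le_S := @schur_midpoint n A B M Apd Bpd Ms (lt0r_neq0 m0) le_M.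
have Apd' := @posdefmx_schur n A Apd; have Bpd' := @posdefmx_schur n B Bpd.
have dA := posdefmx_det Apd'; have dB := posdefmx_det Bpd'.
have [] := IH _ _ (@schur n M) Apd' Bpd'.
- exact: sym_schur.
- exact: (@schur_midpoint_le n A B M Apd Bpd Ms (lt0r_neq0 m0) le_M).
rewrite (@det_schur n A) ?gt_eqF// (@det_schur n B) ?gt_eqF//.
rewrite (@det_schur n M) ?gt_eqF//.
move: a0 b0 abm m0 dA dB.
have eqA := @schur_inj n A M As Ms; have eqB := @schur_inj n B M Bs Ms.
move: le_S eqA eqB.
set a := A 0 0; set b := B 0 0; set m := M 0 0.
set S := \det (schur A); set T := \det (schur B); set U := \det (schur M).
move=> le_S eqA eqB a0 b0 abm m0 dA dB le_ST eq_ST.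
have le_ab : a * b <= m ^+ 2.
  have : (a + b) ^+ 2 <= (2 * m) ^+ 2 by rewrite lerXn2r ?nnegrE//; lra.
  have := sqr_ge0 (a - b); rewrite !expr2; lra.
have -> : a * S * (b * T) = (a * b) * (S * T) by ring.
rewrite exprMn; split; first by rewrite ler_pM// mulr_ge0// ltW.
have ST0 : 0 < S * T by exact: mulr_gt0.
move=> eq_d.
(* As [S * T] is positive, strictness for the pivots would make the product strict. *)
have eq_ab : a * b = m ^+ 2.
  apply/eqP; rewrite eq_le le_ab/= leNgt; apply/negP => lt_ab.
  have : a * b * (S * T) < m ^+ 2 * U ^+ 2.
    by apply: (@lt_le_trans _ _ (m ^+ 2 * (S * T)));
      rewrite ?ltr_pM2r// ler_pM2l// exprn_gt0.
  by rewrite eq_d ltxx.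
have [] := eq_ST.
  by move: eq_d; rewrite eq_ab => /mulfI ->//; rewrite gt_eqF// exprn_gt0.
have am : a = b.
  have : (a + b) ^+ 2 <= (2 * m) ^+ 2 by rewrite lerXn2r ?nnegrE//; lra.
  rewrite exprMn -eq_ab => h; apply/eqP; rewrite -subr_eq0 -sqrf_eq0.
  rewrite eq_le sqr_ge0 andbT; move: h; rewrite !expr2; lra.
have bm : b = m.
  by apply/eqP; rewrite -(@eqrXn2 _ 2) ?ltW// -eq_ab am expr2.
move=> SA SB.
(* With equal pivots and equal Schur complements, [le_S] reduces to a sum of two squares being at
   most 0. *)
have sq y : schur_row A y = schur_row M y /\ schur_row B y = schur_row M y.
  have := le_S y; rewrite SA SB am bm.
  have := sqr_ge0 (schur_row A y - schur_row M y).
  have := sqr_ge0 (schur_row B y - schur_row M y).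
  set u := (schur_row A y - _) ^+ 2; set v := (schur_row B y - _) ^+ 2.
  move=> v0 u0 h.
  have uv : m * (u + v) <= 0 by lra.
  have {}uv : u + v <= 0 by move: uv; rewrite pmulr_rle0.
  have /eqP : u = 0 by lra.
  have /eqP : v = 0 by lra.
  by rewrite !sqrf_eq0 !subr_eq0 => /eqP-> /eqP->.
split.
- by apply: eqA => //; [rewrite gt_eqF|rewrite am|move=> y; have [] := sq y].
- by apply: eqB => //; [rewrite gt_eqF|move=> y; have [] := sq y].
Qed.

End quadratic_form.

(** * Entry and determinant bounds for positive definite matrices *)

Section quadratic_form_bounds.
Context {R : realType}.

Lemma qfDZ n (Q : 'M[R]_n) (x y : 'cV[R]_n) c : Q^T = Q ->
  qf Q (x + c *: y) = qf Q x + 2 * c * dotv y (Q *m x) + c ^+ 2 * qf Q y.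
Proof.
move=> Qs; rewrite /qf !dotvE linearD/= linearZ/= mulmxDl mulmxDr.
rewrite -[Q *m (c *: y)]scalemxAr.
rewrite !mulmxDr -!scalemxAl -!scalemxAr.
have -> : x^T *m (Q *m y) = (y^T *m (Q *m x))^T.
  by rewrite !trmx_mul trmxK Qs mulmxA.
by rewrite !mxE; ring.
Qed.

(** The form is nonnegative at the sum and at the difference of the two basis vectors. *)
Lemma posdefmx_entry n (Q : 'M[R]_n) i j : posdefmx Q ->
  `|Q i j| <= Q i i + Q j j.
Proof.
move=> Qpd; have [Qs _] := Qpd.
have eji : dotv (delta_mx j 0) (Q *m delta_mx i 0) = Q i j.
  by rewrite dotvE trmx_delta -colE -rowE !mxE -[in LHS]Qs mxE.
have := posdefmx_qf (delta_mx i 0 + 1 *: delta_mx j 0) Qpd.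
have := posdefmx_qf (delta_mx i 0 + (- 1) *: delta_mx j 0) Qpd.
have := posdefmx_diag i Qpd; have := posdefmx_diag j Qpd.
by rewrite !qfDZ// eji !qf_delta ler_norml; lra.
Qed.

(** If the form vanishes at [x], then moving from [x] in the direction [- Q x] would make it
    negative unless [Q x = 0]. This recovers definiteness for limits of positive definite matrices
    with nonzero determinant. *)
Lemma psd_unit_posdefmx n (Q : 'M[R]_n) : Q^T = Q ->
  (forall x, 0 <= qf Q x) -> Q \in unitmx -> posdefmx Q.
Proof.
move=> Qs Q0 Qu; split=> // x x0; rewrite lt_neqAle Q0 andbT eq_sym.
apply: contra_neq x0; rewrite -/(qf Q x) => qx.
(* With [d] the squared norm of [Q x] and [c] the form at [Q x], the optimal step is [d / c]; the
   denominator [1 + c] also covers [c = 0]. *)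
have := Q0 (x + - (dotv (Q *m x) (Q *m x) / (1 + qf Q (Q *m x))) *: (Q *m x)).
rewrite qfDZ// qx add0r; have := Q0 (Q *m x).
move: (qf Q (Q *m x)) (dotv_ge0 (Q *m x)) => c d0 c0.
set d := dotv _ _ in d0 *.
rewrite (_ : 2 * _ * d + _ = - (d ^+ 2 * ((2 + c) / (1 + c) ^+ 2))); last first.
  by field; clear -c0; lra.
rewrite oppr_ge0 pmulr_lle0; last first.
  by clear -c0; rewrite divr_gt0 ?exprn_gt0//; lra.
move=> d2; have /eqP : d ^+ 2 = 0 by apply/eqP; rewrite eq_le d2 sqr_ge0.
rewrite sqrf_eq0 => /eqP; rewrite /d.
move=> /dotv_eq0 Qx; by rewrite -(mulKmx Qu x) Qx mulmx0.
Qed.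

Lemma posdefmxD n (A B : 'M[R]_n) : posdefmx A -> posdefmx B -> posdefmx (A + B).
Proof.
move=> [As A0] [Bs B0]; split; first by rewrite linearD/= As Bs.
by move=> x x0; rewrite -/(qf _ _) qfD addr_gt0//; [exact: A0|exact: B0].
Qed.

Lemma posdefmxZ n c (A : 'M[R]_n) : 0 < c -> posdefmx A -> posdefmx (c *: A).
Proof.
move=> c0 [As A0]; split; first by rewrite linearZ/= As.
by move=> x x0; rewrite -/(qf _ _) qfZ mulr_gt0//; exact: A0.
Qed.

Lemma posdefmx_gram n (A : 'M[R]_n) : A \in unitmx -> posdefmx (A^T *m A).
Proof.
move=> Au; apply: psd_unit_posdefmx.
- by rewrite trmx_mul trmxK.
- by move=> x; rewrite -qf_gram dotv_ge0.
- by rewrite unitmx_mul unitmx_tr Au.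
Qed.

Lemma det_le n (A : 'M[R]_n) (c : R) : (forall i j, `|A i j| <= c) ->
  \det A <= n`!%:R * c ^+ n.
Proof.
move=> Ac; apply: le_trans (ler_norm _) _; apply: le_trans (ler_norm_sum _ _ _) _.
rewrite (le_trans (y := \sum_(s : 'S_n) c ^+ n))//; last first.
  by rewrite sumr_const card_Sn mulr_natl.
apply: ler_sum => s _; rewrite normrM normrX normrN1 expr1n mul1r.
rewrite normr_prod -[in leRHS](card_ord n) -prodr_const.
by apply: ler_prod => i _; rewrite normr_ge0 Ac.
Qed.

(** Here [det_midpoint] is applied to the Schur complements only, which keeps the pivots explicit.
    The left side is quadratic in the diagonal entry of [A] and the right side linear, which later
    bounds that entry. *)
Lemma det_midpoint_diag0 n (A B M : 'M[R]_(1 + n)) :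
  posdefmx A -> posdefmx B -> M = 2^-1 *: (A + B) ->
  \det A * \det B * M 0 0 ^+ 2 <= A 0 0 * B 0 0 * \det M ^+ 2.
Proof.
move=> Apd Bpd ME.
have a0 := posdefmx_diag 0 Apd; have b0 := posdefmx_diag 0 Bpd.
have Mpd : posdefmx M.
  by rewrite ME; apply: posdefmxZ; [lra|exact: posdefmxD].
have m0 := posdefmx_diag 0 Mpd.
have [As _] := Apd; have [Bs _] := Bpd; have [Ms _] := Mpd.
have Apd' := posdefmx_schur Apd; have Bpd' := posdefmx_schur Bpd.
have dA := posdefmx_det Apd'; have dB := posdefmx_det Bpd'.
have [|le_d _] := det_midpoint Apd' Bpd' (sym_schur Ms).
  apply: schur_midpoint_le => //; first exact: lt0r_neq0.
  by move=> x; rewrite ME qfZ qfD; lra.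
rewrite (det_schur As (lt0r_neq0 a0)) (det_schur Bs (lt0r_neq0 b0)).
rewrite (det_schur Ms (lt0r_neq0 m0)).
move: (\det (schur A)) (\det (schur B)) (\det (schur M)) le_d => S T U le_d.
rewrite [leLHS](_ : _ = A 0 0 * B 0 0 * M 0 0 ^+ 2 * (S * T)); last by ring.
by rewrite exprMn [leRHS]mulrA ler_wpM2l// mulr_ge0// ?sqr_ge0// mulr_ge0// ltW.
Qed.

Lemma det_perm_conj n (s : 'S_n) (A : 'M[R]_n) :
  \det (row_perm s (col_perm s A)) = \det A.
Proof.
rewrite row_permE col_permE !det_mulmx !det_perm odd_permV.
by rewrite mulrC -mulrA -signr_addb addbb mulr1.
Qed.

Lemma qf_conj n (P Q : 'M[R]_n) x : qf (P^T *m Q *m P) x = qf Q (P *m x).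
Proof. by rewrite /qf !dotvE trmx_mul !mulmxA. Qed.

Lemma posdefmx_perm n (s : 'S_n) (A : 'M[R]_n) : posdefmx A ->
  posdefmx (row_perm s (col_perm s A)).
Proof.
move=> Apd; have [As A0] := Apd.
have PE : row_perm s (col_perm s A) = (perm_mx s)^T^T *m A *m (perm_mx s)^T.
  by rewrite trmxK tr_perm_mx row_permE col_permE mulmxA.
apply: psd_unit_posdefmx.
- by rewrite PE !trmx_mul As !trmxK mulmxA.
- by move=> x; rewrite PE qf_conj posdefmx_qf.
- by rewrite unitmxE det_perm_conj -unitmxE; exact: posdefmx_unit.
Qed.

(** Exchanging the indices 0 and [i] in rows and columns preserves determinants, definiteness and
    midpoints. *)
Lemma det_midpoint_diag n (A B M : 'M[R]_n) i :
  posdefmx A -> posdefmx B -> M = 2^-1 *: (A + B) ->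
  \det A * \det B * M i i ^+ 2 <= A i i * B i i * \det M ^+ 2.
Proof.
case: n A B M i => [|n] A B M i; first by case: i.
move=> Apd Bpd ME; pose s := tperm 0 i.
have := @det_midpoint_diag0 n _ _ (row_perm s (col_perm s M))
  (posdefmx_perm s Apd) (posdefmx_perm s Bpd).
rewrite !det_perm_conj !mxE !tpermL; apply.
by rewrite ME; apply/matrixP => k l; rewrite !mxE.
Qed.

End quadratic_form_bounds.

(** * Gaussian integrals *)

Section gaussian_integral.
Context {R : realType}.

(** Up to its peak value, the integrand is the normal density of mean [- s] and variance
    [1 / (2 * q)]. *)
Lemma integral_gaussian1 (q s : R) : 0 < q ->
  (\int[lebesgue_measure]_t (expR (- (q * (t + s) ^+ 2)))%:E)%E =
  (Num.sqrt (pi / q))%:E.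
Proof.
move=> q0; pose sg := Num.sqrt (2 * q)^-1.
have sg2 : sg ^+ 2 *+ 2 = q^-1.
  by rewrite sqr_sqrtr ?invr_ge0 ?mulr_ge0// ?ltW// -mulr_natr; field; rewrite gt_eqF.
have sg0 : sg != 0 by rewrite gt_eqF// sqrtr_gt0 invr_gt0 mulr_gt0.
have pk : normal_peak sg = (Num.sqrt (pi / q))^-1.
  by rewrite /normal_peak -mulrnAl sg2 mulrC.
have pk0 : 0 < Num.sqrt (pi / q) by rewrite sqrtr_gt0 divr_gt0// pi_gt0.
transitivity (\int[lebesgue_measure]_t
    ((Num.sqrt (pi / q))%:E * (normal_pdf (- s) sg t)%:E))%E.
  apply: eq_integral => t _; rewrite normal_pdfE// pk -EFinM mulVKf ?gt_eqF//.
  by rewrite /normal_fun sg2 invrK opprK mulNr mulrC.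
rewrite ge0_integralZl//.
- by rewrite integral_normal_pdf mule1.
- by apply/measurable_EFinP; exact: measurable_normal_pdf.
- by move=> t _; rewrite lee_fin normal_pdf_ge0.
Qed.

Lemma measurable_qf n (Q : 'M[R]_n) (c : 'cV[R]_n) :
  measurable_fun [set: 'cV[R]_n] (fun x => qf Q (x - c)).
Proof.
have mcoord i : measurable_fun [set: 'cV[R]_n] (fun x => (x - c) i 0).
  have -> : (fun x : 'cV[R]_n => (x - c) i 0) = (fun x => cV_coord i x - c i 0).
    by apply/funext => x; rewrite !mxE.
  apply: measurable_funB => //; exact: (measurable_cV_coord (T2 := R) i).
apply: measurable_sum => i; apply: measurable_funM => //.
have -> : (fun x : 'cV[R]_n => (Q *m (x - c)) i 0) =
    (fun x => \sum_j Q i j * (x - c) j 0).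
  by apply/funext => x; rewrite mxE.
by apply: measurable_sum => j; apply: measurable_funM.
Qed.

Lemma measurable_gaussian n (Q : 'M[R]_n) (c : 'cV[R]_n) :
  measurable_fun [set: 'cV[R]_n] (fun x => expR (- qf Q (x - c))).
Proof.
apply: measurableT_comp => //.
by apply: measurableT_comp => //; exact: measurable_qf.
Qed.

Lemma cV_cons_sub n (t s : R) (x y : 'cV[R]_n) :
  cV_cons (t, x) - cV_cons (s, y) = cV_cons (t - s, x - y).
Proof.
rewrite /cV_cons/= (@opp_col_mx R 1 n 1) (@add_col_mx R 1 n 1).
by rewrite (_ : const_mx t - const_mx s = const_mx (t - s))//;
  apply/matrixP => i j; rewrite !mxE.
Qed.

Lemma cV_unconsK n : cancel (@cV_uncons R n) (@cV_cons R n).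
Proof.
move=> x; apply/matrixP => i j; rewrite ord1 {j}; case: (unliftP ord0 i) => [j|] ->.
- have -> : lift ord0 j = rshift 1 j :> 'I_(1 + n) by exact/val_inj.
  by rewrite /cV_cons (@col_mxEd R 1 n 1) mxE; congr (x _ _); exact/val_inj.
- have -> : ord0 = lshift n ord0 :> 'I_(1 + n) by exact/val_inj.
  by rewrite /cV_cons (@col_mxEu R 1 n 1) mxE; congr (x _ _); exact/val_inj.
Qed.

(** Tonelli, with the first coordinate innermost: the square will be completed in [t] at fixed
    [y]. *)
Lemma integral_cV_cons n (f : 'cV[R]_n.+1 -> R) :
  measurable_fun [set: 'cV[R]_n.+1] f ->
  (forall x, 0 <= f x) ->
  integral_cV f = (\int[lebesgue_cV n]_y \int[lebesgue_measure]_t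
    (f (cV_cons (t, y)))%:E)%E.
Proof.
move=> mf f0; rewrite /integral_cV/=.
rewrite ge0_integral_pushforward//.
- rewrite preimage_setT fubini_tonelli2//=.
  + apply/measurable_EFinP; apply: measurableT_comp => //; exact: measurable_cV_cons.
  + by move=> x; rewrite lee_fin.
- exact: measurable_cV_cons.
- exact/measurable_EFinP.
- by move=> x _; rewrite lee_fin.
Qed.

(** After completing the square, the inner integral is a shifted one-dimensional Gaussian whose
    value does not depend on [y]; the Schur form remains for the induction. *)
Lemma integral_qf n (Q : 'M[R]_n) (c : 'cV[R]_n) : posdefmx Q ->
  integral_cV (fun x => expR (- qf Q (x - c))) =
  (Num.sqrt pi ^+ n / Num.sqrt (\det Q))%:E.
Proof.
elim: n Q c => [|n IH] Q c Qpd.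
  rewrite /integral_cV /= integral_dirac//.
    rewrite diracT mul1e det_mx00 sqrtr1 divr1 /qf /dotv big_ord0 oppr0.
    by rewrite expR0.
  apply/measurable_EFinP; exact: measurable_gaussian.
have q0 := @posdefmx_diag _ (1 + n) Q 0 Qpd; have [Qs _] := Qpd.
have Spd := @posdefmx_schur _ n Q Qpd.
rewrite integral_cV_cons//; last exact: measurable_gaussian.
rewrite -(cV_unconsK c); move: (cV_uncons c) => [c0 c'].
transitivity (\int[lebesgue_cV n]_y ((Num.sqrt (pi / (Q 0 0)))%:E *
  (expR (- qf (@schur _ n Q) (y - c')))%:E))%E.
  apply: eq_integral => y _.
  rewrite muleC -(integral_gaussian1 (- c0 + @schur_row _ n Q (y - c')) q0).
  rewrite -ge0_integralZl//.
  - apply: eq_integral => t _; rewrite cV_cons_sub -EFinM -expRD.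
    rewrite /cV_cons (@qf_schur _ n Q) ?lt0r_neq0//=.
    by congr (expR _)%:E; rewrite opprD addrC addrA.
  - apply/measurable_EFinP; apply: measurableT_comp => //.
    apply: measurableT_comp => //; apply: measurable_funM => //.
    by apply: measurable_funX; exact: measurable_funD.
rewrite ge0_integralZl//.
- rewrite [X in (_ * X)%E](IH _ c' Spd) -EFinM.
  rewrite (@det_schur _ n Q) ?lt0r_neq0// sqrtrM ?pi_ge0// sqrtrM ?ltW// sqrtrV ?ltW//.
  by congr EFin; rewrite exprS invfM; ring.
- apply/measurable_EFinP; exact: measurable_gaussian.
Qed.

Definition gauss n (A : 'M[R]_n) (al : R) (a x : 'cV[R]_n) : R :=
  al * expR (- dotv (invmx A *m (x - a)) (invmx A *m (x - a))).

Lemma integral_gauss n (A : 'M[R]_n) (al : R) a : posdefmx A -> 0 < al ->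
  integral_cV (gauss A al a) = (Num.sqrt pi ^+ n * (al * \det A))%:E.
Proof.
move=> Apd al0; have Au := posdefmx_unit Apd; have dA := posdefmx_det Apd.
have Qpd : posdefmx ((invmx A)^T *m invmx A).
  by apply: posdefmx_gram; rewrite unitmx_inv.
transitivity (\int[lebesgue_cV n]_x
   (al%:E * (expR (- qf ((invmx A)^T *m invmx A) (x - a)))%:E))%E.
  by apply: eq_integral => x _; rewrite /gauss qf_gram EFinM.
rewrite ge0_integralZl//.
- rewrite [X in (_ * X)%E](integral_qf a Qpd) -EFinM det_mulmx det_tr -expr2.
  by rewrite sqrtr_sqr det_inv normfV invrK gtr0_norm// mulrCA.
- apply/measurable_EFinP; exact: measurable_gaussian.
- by rewrite lee_fin ltW.
Qed.

(* The library's [ge0_le_integral] would require [g] to be measurable. *)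
Lemma le_integral_cV n (f g : 'cV[R]_n -> R) : (forall x, 0 <= f x) ->
  (forall x, f x <= g x) -> (integral_cV f <= integral_cV g)%E.
Proof.
move=> f0 fg; rewrite /integral_cV !ge0_integralTE//.
- apply: le_ereal_sup => _ [h hf <-]; exists h => // x.
  by apply: le_trans (hf x) _; rewrite lee_fin.
- by move=> x; rewrite lee_fin (le_trans (f0 x)).
Qed.

(** * Unit cubes and their measure *)

Definition cube n (c : 'cV[R]_n) : set 'cV[R]_n :=
  [set x | forall i, c i 0 - 2^-1 <= x i 0 <= c i 0 + 2^-1].

Lemma cV_cons0 n (t : R) (y : 'cV[R]_n) : cV_cons (t, y) ord0 0 = t.
Proof. exact: (congr1 fst (cV_consK (t, y))). Qed.

Lemma cV_consS n (t : R) (y : 'cV[R]_n) i :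
  cV_cons (t, y) (lift ord0 i) 0 = y i 0.
Proof.
by have := congr1 (fun p : R * 'cV[R]_n => p.2 i 0) (cV_consK (t, y)); rewrite /= mxE.
Qed.

Lemma cube_cons n (c : 'cV[R]_n.+1) : @cV_cons R n @^-1` (cube c) =
  `[c ord0 0 - 2^-1, c ord0 0 + 2^-1] `*` cube (cV_uncons c).2.
Proof.
apply/seteqP; split => [[t y]/= h|[t y]/= [ht hy] i].
- split; first by have := h ord0; rewrite cV_cons0 in_itv.
  by move=> i; have := h (lift ord0 i); rewrite cV_consS mxE.
- case: (unliftP ord0 i) => [j|] ->; last by rewrite in_itv in ht; rewrite cV_cons0.
  by have := hy j; rewrite cV_consS mxE.
Qed.

Lemma measurable_cube n (c : 'cV[R]_n) : measurable (cube c).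
Proof.
have -> : cube c = \bigcap_(i in [set: 'I_n])
    (cV_coord i @^-1` `[c i 0 - 2^-1, c i 0 + 2^-1]).
  apply/seteqP; split => [x h i _|x h i]; first by rewrite /= in_itv; exact: h.
  by have := h i Logic.I; rewrite /= in_itv.
apply: fin_bigcap_measurable => // i _; rewrite -[X in measurable X]setTI.
exact: (measurable_cV_coord (T2 := R) i).
Qed.

Lemma lebesgue_cube n (c : 'cV[R]_n) : lebesgue_cV n (cube c) = 1%E.
Proof.
elim: n c => [|n IH] c.
  by rewrite /= diracE mem_set// => -[].
rewrite /= /cons_measure /pushforward cube_cons product_measure1E//.
- rewrite [X in (_ * X)%E]IH mule1.
  have := @lebesgue_measure_itv R `[(c ord0 0 - 2^-1), (c ord0 0 + 2^-1)].
  rewrite /= lte_fin ifT => [->|]; last by lra.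
  by rewrite -EFinB; congr EFin; lra.
- exact: measurable_cube.
Qed.

End gaussian_integral.

(** * Gaussians below a log-concave function *)

Section gaussians_below.
Context {R : realType} {d : nat}.
Implicit Types (f : 'cV[R]_d -> R) (A : 'M[R]_d) (al : R) (a : 'cV[R]_d).

Lemma log_concave_ln f : log_concave f -> (forall x, 0 < f x) ->
  forall x y t, 0 <= t <= 1 ->
  t * ln (f x) + (1 - t) * ln (f y) <= ln (f (t *: x + (1 - t) *: y)).
Proof.
move=> [psi [[psiNy psi_cvx] fE]] f0 x y t t01.
(* The value [-oo] is excluded by convexity, and [+oo] would give [f z = 0]. *)
have psiE z : psi z = (- ln (f z))%:E.
  have := fE z; have := psiNy z; case: (psi z) => [r| |]//= _.
    by move=> [->]; rewrite expRK opprK.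
  by move=> [fz]; have := f0 z; rewrite fz ltxx.
have := psi_cvx x y t t01; rewrite !psiE -!EFinM -EFinD lee_fin; lra.
Qed.

Lemma log_concave_midpoint f : log_concave f -> (forall x, 0 < f x) ->
  forall x y, f x * f y <= f (2^-1 *: (x + y)) ^+ 2.
Proof.
move=> lcf f0 x y; have h01 : 0 <= (2^-1 : R) <= 1 by lra.
have := log_concave_ln lcf f0 x y h01; rewrite scalerDr.
have -> : 1 - 2^-1 = 2^-1 :> R by lra.
move=> h; rewrite -ler_ln ?posrE ?mulr_gt0 ?exprn_gt0// lnM ?posrE// lnXn//.
by rewrite mulr2n; lra.
Qed.

Lemma log_concave_min f (m : R) : log_concave f -> (forall x, 0 < f x) ->
  forall x y t, 0 <= t <= 1 -> 0 < m -> m <= f x -> m <= f y ->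
  m <= f (t *: x + (1 - t) *: y).
Proof.
move=> lcf f0 x y t t01 m0 mx my.
have := log_concave_ln lcf f0 x y t01.
rewrite -[m <= _]ler_ln ?posrE//; apply: le_trans.
have lx : ln m <= ln (f x) by rewrite ler_ln ?posrE.
have ly : ln m <= ln (f y) by rewrite ler_ln ?posrE.
have -> : ln m = t * ln m + (1 - t) * ln m by ring.
by apply: lerD; apply: ler_wpM2l => //; lra.
Qed.

Lemma gauss_gt0 A al a x : 0 < al -> 0 < gauss A al a x.
Proof. by move=> al0; rewrite mulr_gt0// expR_gt0. Qed.

(** The substitution [x = a + A u] removes the inverse matrix: for fixed [u] the condition involves
    [A] and [a] only through an affine expression, which suits midpoints and limits alike. *)
Lemma gauss_belowP f A al a : A \in unitmx ->
  (forall x, gauss A al a x <= f x) <->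
  (forall u, al * expR (- dotv u u) <= f (a + A *m u)).
Proof.
move=> Au; split => h x.
- by have := h (a + A *m x); rewrite /gauss addrAC subrr add0r mulKmx.
- by have := h (invmx A *m (x - a)); rewrite mulKVmx// [a + _]addrC subrK.
Qed.

Lemma gaussian_belowE f g : gaussian_below f g ->
  exists A al a, [/\ posdefmx A, 0 < al, g = gauss A al a &
    forall x, gauss A al a x <= f x].
Proof.
move=> [[A [al [a [Apd al0 gE]]]] gf]; exists A, al, a; split => //.
  by apply/funext.
by move=> x; rewrite /gauss -gE.
Qed.

Lemma gauss_below f A al a : posdefmx A -> 0 < al ->
  (forall x, gauss A al a x <= f x) -> gaussian_below f (gauss A al a).
Proof. by move=> Apd al0 h; split => //; exists A, al, a. Qed.

(** For fixed [u], the point attached to the averaged parameters is the midpoint of the points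
    attached to the two Gaussians, so midpoint log-concavity applies. *)
Lemma gauss_midpoint f A1 al1 a1 A2 al2 a2 :
  log_concave f -> (forall x, 0 < f x) ->
  posdefmx A1 -> posdefmx A2 -> 0 < al1 -> 0 < al2 ->
  (forall x, gauss A1 al1 a1 x <= f x) -> (forall x, gauss A2 al2 a2 x <= f x) ->
  forall x, gauss (2^-1 *: (A1 + A2)) (Num.sqrt (al1 * al2)) (2^-1 *: (a1 + a2)) x <= f x.
Proof.
move=> lcf f0 pd1 pd2 al10 al20.
move=> /(gauss_belowP _ _ _ (posdefmx_unit pd1)) h1.
move=> /(gauss_belowP _ _ _ (posdefmx_unit pd2)) h2.
have Mpd : posdefmx (2^-1 *: (A1 + A2)).
  by apply: posdefmxZ; [lra|exact: posdefmxD].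
apply/(gauss_belowP _ _ _ (posdefmx_unit Mpd)) => u.
rewrite -(@ler_pXn2r _ 2) ?nnegrE//; last exact/ltW.
have -> : 2^-1 *: (a1 + a2) + 2^-1 *: (A1 + A2) *m u =
    2^-1 *: ((a1 + A1 *m u) + (a2 + A2 *m u)).
  by rewrite -scalemxAl -scalerDr mulmxDl addrACA.
apply: le_trans (log_concave_midpoint lcf f0 _ _).
rewrite exprMn sqr_sqrtr; last by rewrite mulr_ge0// ltW.
rewrite expr2 mulrACA; apply: ler_pM => //; by rewrite mulr_ge0// ?expR_ge0 ?ltW.
Qed.

Lemma max_gauss_translate f g h : log_concave f -> (forall x, 0 < f x) ->
  max_gaussian_below f g -> max_gaussian_below f h -> translate_of g h.
Proof.
move=> lcf f0 [gb gmax] [hb hmax].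
have := gmax _ hb; have := hmax _ gb.
have [A [al [a [Apd al0 gE gf]]]] := gaussian_belowE gb.
have [B [be [b [Bpd be0 hE hf]]]] := gaussian_belowE hb.
have Mpd : posdefmx (2^-1 *: (A + B)).
  by apply: posdefmxZ; [lra|exact: posdefmxD].
have s0 : 0 < Num.sqrt (al * be) by rewrite sqrtr_gt0 mulr_gt0.
have := gmax _ (gauss_below Mpd s0 (gauss_midpoint lcf f0 Apd Bpd al0 be0 gf hf)).
have k0 : 0 < Num.sqrt pi ^+ d :> R by rewrite exprn_gt0// sqrtr_gt0 pi_gt0.
rewrite gE hE !integral_gauss// !lee_fin !ler_pM2l//.
have dA := posdefmx_det Apd; have dB := posdefmx_det Bpd; have dM := posdefmx_det Mpd.
set M := 2^-1 *: _ in Mpd dM *.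
move=> le_M le_gh le_hg.
have eq_gh : al * \det A = be * \det B by apply/eqP; rewrite eq_le le_gh le_hg.
have [||le_d eq_d] := @det_midpoint _ _ _ _ M Apd Bpd; first by case: Mpd.
  by move=> x; rewrite qfZ qfD; lra.
(* The midpoint has value at most the common maximum. Squaring and cancelling [al * be] gives the
   reverse of [le_d], hence equality. *)
have : \det M ^+ 2 <= \det A * \det B.
  rewrite -(ler_pM2l (mulr_gt0 al0 be0)).
  rewrite [leRHS](_ : _ = (al * \det A) * (be * \det B)); last by ring.
  rewrite -eq_gh -expr2 -[al * be]sqr_sqrtr -?exprMn; last exact/ltW/mulr_gt0.
  by rewrite ler_pXn2r// nnegrE mulr_ge0// ltW.
move=> ge_d; have [|AM BM] := eq_d; first by apply/eqP; rewrite eq_le le_d ge_d.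
have AB : A = B by rewrite AM.
have ab : al = be by move: eq_gh; rewrite AB => /mulIf ->//; rewrite gt_eqF.
exists (b - a) => x; rewrite /gauss AB ab.
by have -> : x - (b - a) - a = x - b by rewrite opprB addrA addrAC addrK.
Qed.

End gaussians_below.

(** * A priori bounds on the parameters *)

Section gaussians_below_bounded.
Context {R : realType} {d : nat}.
Implicit Types (f : 'cV[R]_d -> R) (A : 'M[R]_d) (al : R) (a : 'cV[R]_d).

Lemma gauss_center A al a : gauss A al a a = al.
Proof.
rewrite /gauss subrr mulmx0 /dotv big1 ?oppr0 ?expR0 ?mulr1// => i _.
by rewrite mxE mul0r.
Qed.

Lemma gauss_value_bounded f : (integral_cV f < +oo)%E ->
  exists2 J : R, 0 <= J & forall A al a, posdefmx A -> 0 < al ->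
    (forall x, gauss A al a x <= f x) -> al * \det A <= J.
Proof.
move=> foo; have k0 : 0 < Num.sqrt pi ^+ d :> R.
  by rewrite exprn_gt0// sqrtr_gt0 pi_gt0.
exists (`|fine (integral_cV f)| / Num.sqrt pi ^+ d).
  by rewrite divr_ge0// ltW.
move=> A al a Apd al0 le_f; rewrite ler_pdivlMr// mulrC.
have := le_integral_cV (fun x => ltW (gauss_gt0 A a x al0)) le_f.
rewrite integral_gauss//; case: (integral_cV f) foo => [r _|//|//] /=.
by rewrite lee_fin => /le_trans; apply; exact: ler_norm.
Qed.

Lemma dotv_mul_bounded (B : 'M[R]_d) : exists2 K : R, 0 <= K &
  forall z : 'cV[R]_d, (forall i, `|z i 0| <= 1) -> dotv (B *m z) (B *m z) <= K.
Proof.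
exists (\sum_i (\sum_j `|B i j|) ^+ 2); first by apply: sumr_ge0 => i _; exact: sqr_ge0.
move=> z z1; apply: ler_sum => i _; rewrite -expr2 -real_normK ?num_real//.
rewrite lerXn2r ?nnegrE ?sumr_ge0//.
rewrite mxE; apply: le_trans (ler_norm_sum _ _ _) _; apply: ler_sum => j _.
by rewrite normrM ler_piMr.
Qed.

Lemma superlevel_bounded f A0 al0 a0 (be : R) : log_concave f ->
  (forall x, 0 < f x) -> (integral_cV f < +oo)%E ->
  posdefmx A0 -> 0 < al0 -> (forall x, gauss A0 al0 a0 x <= f x) -> 0 < be ->
  exists C : R, forall a, be <= f a -> forall i, `|a i 0| <= C.
Proof.
move=> lcf f0 foo A0pd al00 le_f be0.
have [K K0 Kz] := dotv_mul_bounded (invmx A0).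
(* A common lower bound for [f] at [a] and on the cube of side 2 around [a0]. *)
pose m := Num.min be (al0 * expR (- K)).
have m0 : 0 < m by rewrite lt_min be0 mulr_gt0// expR_gt0.
have near_a0 (z : 'cV[R]_d) : (forall i, `|z i 0| <= 1) -> m <= f (a0 + z).
  move=> z1; apply: le_trans (le_f _); rewrite /m /gauss ge_min; apply/orP; right.
  by rewrite ler_pM2l// ler_expR lerN2 [a0 + z]addrC addrK Kz.
have m_be : m <= be by rewrite ge_min lexx.
(* Enough unit cubes for the lower bound [m] to exceed the integral of [f]. *)
pose N := (Num.bound (`|fine (integral_cV f)| / m)).+1.
have fN : fine (integral_cV f) < m * N%:R.
  rewrite mulrC -ltr_pdivrMr//; apply: (@le_lt_trans _ _ (`|fine (integral_cV f)| / m)).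
    by rewrite ler_pM2r ?invr_gt0// ler_norm.
  apply: lt_le_trans (archi_boundP _) _; first by rewrite divr_ge0// ltW.
  by rewrite ler_nat.
exists (\sum_i `|a0 i 0| + (2 * N)%:R) => a fa i.
suff h : `|a i 0 - a0 i 0| <= (2 * N)%:R.
  rewrite -(subrK (a0 i 0) (a i 0)) addrC; apply: le_trans (ler_normD _ _) _.
  apply: lerD => //; rewrite (bigD1 i)//= lerDl sumr_ge0//.
rewrite leNgt; apply/negP => far.
(* With spacing [1 / (2 * N)], the assumption [far] separates distinct [p k] by more than 1 in
   coordinate [i], so their unit cubes are disjoint. *)
pose s (k : nat) : R := k%:R / (2 * N)%:R.
(* Since [s k <= 1/2], log-concavity transports the bound [m] from the cube of
   side 2 around [a0] to the unit cube around each [p k]. *)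
pose p k := s k *: a + (1 - s k) *: a0.
have N0 : 0 < (2 * N)%:R :> R by rewrite ltr0n muln_gt0.
have s_bd k : (k < N)%N -> 0 <= s k <= 2^-1.
  move=> kN; rewrite /s divr_ge0 ?ler0n//= ler_pdivrMr//.
  by rewrite natrM mulrA mulVf ?mul1r ?ler_nat 1?ltnW// pnatr_eq0.
have f_cube k x : (k < N)%N -> cube (p k) x -> m <= f x.
  move=> kN xp; have /andP[s0 s1] := s_bd _ kN.
  have t0 : 0 < 1 - s k by lra.
  have -> : x = s k *: a + (1 - s k) *: (a0 + (1 - s k)^-1 *: (x - p k)).
    rewrite scalerDr scalerA mulfV ?gt_eqF// scale1r addrA -/(p k).
    by rewrite addrC subrK.
  apply: log_concave_min => //; [lra|exact: le_trans fa|].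
  apply: near_a0 => j; rewrite !mxE normrM normfV (gtr0_norm t0).
  rewrite mulrC ler_pdivrMr// mul1r; apply: (@le_trans _ _ 2^-1); last lra.
  by have := xp j; rewrite !mxE ler_norml; lra.
pose U := \big[setU/set0]_(k < N) cube (p k).
have mU : measurable U by apply: bigsetU_measurable => k _; exact: measurable_cube.
have muU : lebesgue_cV d U = (N%:R)%:E.
  rewrite /U measure_bigsetU_ord//.
  - rewrite (eq_bigr (fun=> 1%:E)); last by move=> k _; exact: lebesgue_cube.
    by rewrite sumEFin sumr_const card_ord.
  - by move=> k; exact: measurable_cube.
  - apply/trivIsetP => k l _ _ kl; apply/seteqP; split => // x [xk xl].
    have kl1 : 1 <= `|(k : nat)%:R - (l : nat)%:R| :> R.
      move: kl; rewrite -(inj_eq val_inj)/= neq_ltn => /orP[] lt_kl.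
        by rewrite distrC -natrB 1?ltnW// normr_nat ler1n subn_gt0.
      by rewrite -natrB 1?ltnW// normr_nat ler1n subn_gt0.
    have : `|p k i 0 - p l i 0| <= 1.
      by have := xk i; have := xl i; rewrite ler_norml; lra.
    have -> : p k i 0 - p l i 0 =
        ((k : nat)%:R - (l : nat)%:R) * ((a i 0 - a0 i 0) / (2 * N)%:R).
      by rewrite /p /s !mxE; field; rewrite gt_eqF.
    rewrite normrM leNgt => /negP; apply.
    apply: (@lt_le_trans _ _ `|(a i 0 - a0 i 0) / (2 * N)%:R|).
      by rewrite normrM normfV (gtr0_norm N0) ltr_pdivlMr// mul1r.
    by rewrite ler_peMl.
have : ((m * N%:R)%:E <= integral_cV f)%E.
  have -> : (m * N%:R)%:E = integral_cV (fun x => m * \1_U x).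
    rewrite /integral_cV; under eq_integral do rewrite EFinM.
    rewrite ge0_integralZl//.
    - by rewrite integral_indic// setIT [X in (_ * X)%E]muU -EFinM.
    - by apply/measurable_EFinP; exact: measurable_indic.
    - by rewrite lee_fin ltW.
  apply: le_integral_cV => x; first by rewrite mulr_ge0// ltW.
  rewrite indicE; case: (boolP (x \in U)) => [|_]; last by rewrite mulr0 ltW.
  by rewrite mulr1 inE /U -(bigcup_mkord N (fun k => cube (p k))) => -[k /= kN];
    exact: f_cube.
case: (integral_cV f) foo fN => [r _|//|//] /=; rewrite lee_fin; lra.
Qed.

Lemma gauss_params_bounded f A0 al0 a0 : log_concave f ->
  (forall x, 0 < f x) -> (integral_cV f < +oo)%E ->
  posdefmx A0 -> 0 < al0 -> (forall x, gauss A0 al0 a0 x <= f x) ->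
  exists C : R, forall A al a, posdefmx A -> 0 < al ->
    (forall x, gauss A al a x <= f x) -> al0 * \det A0 <= al * \det A ->
    [/\ forall i j, `|A i j| <= C, al <= C & forall i, `|a i 0| <= C].
Proof.
move=> lcf f0 foo A0pd al00 le_f0.
have [J J0 leJ] := gauss_value_bounded foo.
have dA0 := posdefmx_det A0pd.
pose de := al0 * \det A0; have de0 : 0 < de by rewrite mulr_gt0.
(* The factor obtained by solving [de ^+ 2 * (x / 2) ^+ 2 <= x * y * J ^+ 2] for [x], where [x] and
   [y] are diagonal entries of [A] and [A0]. *)
pose k := 4 * J ^+ 2 / de ^+ 2.
have k0 : 0 <= k 
  by apply: divr_ge0; [apply: mulr_ge0 => //; exact: sqr_ge0|exact: sqr_ge0].
(* The midpoint with the reference Gaussian is also below [f], so its value is at most [J]; this is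
   the square of that bound. *)
have mid A al a : posdefmx A -> 0 < al -> (forall x, gauss A al a x <= f x) ->
    al * al0 * \det (2^-1 *: (A + A0)) ^+ 2 <= J ^+ 2.
  move=> Apd al_gt0 le_f.
  have Mpd : posdefmx (2^-1 *: (A + A0)) by apply: posdefmxZ; [lra|exact: posdefmxD].
  have s0 : 0 < Num.sqrt (al * al0) by rewrite sqrtr_gt0 mulr_gt0.
  have h := leJ _ _ _ Mpd s0 (gauss_midpoint lcf f0 Apd A0pd al_gt0 al00 le_f le_f0).
  rewrite -[al * al0]sqr_sqrtr; last exact/ltW/mulr_gt0.
  rewrite -exprMn ler_pXn2r ?nnegrE//.
  by rewrite mulr_ge0// ltW// posdefmx_det.
have trA0 i : A0 i i <= \tr A0.
  rewrite /mxtrace (bigD1 i)//= lerDl sumr_ge0// => j _; exact/ltW/posdefmx_diag.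
have trA00 : 0 <= \tr A0 by apply: sumr_ge0 => i _; exact/ltW/posdefmx_diag.
pose C1 := 2 * k * \tr A0.
have C10 : 0 <= C1 by apply: mulr_ge0 => //; exact: mulr_ge0.
have A_le A al a : posdefmx A -> 0 < al -> (forall x, gauss A al a x <= f x) ->
    de <= al * \det A -> forall i j, `|A i j| <= C1.
  move=> Apd al_gt0 le_f le_de.
  have diag i : A i i <= k * \tr A0.
    apply: (@le_trans _ _ (k * A0 i i)); last by rewrite ler_wpM2l.
    have := det_midpoint_diag i Apd A0pd erefl.
    have := mid _ _ _ Apd al_gt0 le_f.
    have Aii := posdefmx_diag i Apd; have A0ii := posdefmx_diag i A0pd.
    have dA := posdefmx_det Apd.
    rewrite !mxE; set D := \det (_ *: _) ^+ 2.
    move: (A i i) (A0 i i) Aii A0ii => x y x_gt0 y_gt0.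
    move=> D_le x_le.
    have : de ^+ 2 * (2^-1 * x) ^+ 2 <= x * y * J ^+ 2.
      apply: (@le_trans _ _ (al * al0 * (\det A * \det A0 * (2^-1 * (x + y)) ^+ 2))).
        rewrite [leRHS]mulrA; apply: ler_pM; rewrite ?sqr_ge0//.
          rewrite [leRHS](_ : _ = al * \det A * de); last by rewrite /de; ring.
          by rewrite expr2 ler_pM2r.
        by rewrite ler_pXn2r// ?nnegrE; lra.
      apply: (@le_trans _ _ (al * al0 * (x * y * D))).
        by rewrite ler_pM2l// mulr_gt0.
      by rewrite mulrCA ler_pM2l// mulr_gt0.
    rewrite /k => h; rewrite -(ler_pM2l x_gt0).
    rewrite mulrAC mulrA ler_pdivlMr ?exprn_gt0//; move: h; rewrite !expr2; lra.
  move=> i j; apply: le_trans (posdefmx_entry i j Apd) _.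
  have := diag i; have := diag j; rewrite /C1; lra.
(* [D] bounds [\det A], and the added 1 keeps it positive. Hence [al], the height at the center, is
   at least [de / D], and the center lies in a fixed superlevel set of [f]. *)
pose D := d`!%:R * C1 ^+ d + 1.
have D0 : 0 < D by rewrite ltr_wpDl// mulr_ge0 ?ler0n// exprn_ge0.
have be0 : 0 < de / D by rewrite divr_gt0.
have [C2 C2P] := superlevel_bounded lcf f0 foo A0pd al00 le_f0 be0.
pose c0 := al0 * \det (2^-1 *: A0) ^+ 2.
have hA0pd : posdefmx (2^-1 *: A0) by apply: posdefmxZ => //; lra.
have c00 : 0 < c0 by rewrite mulr_gt0// exprn_gt0// posdefmx_det.
exists (Num.max C1 (Num.max C2 (J ^+ 2 / c0))) => A al a Apd al_gt0 le_f le_de.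
split.
- by move=> i j; rewrite le_max (A_le A al a).
- rewrite !le_max; apply/orP; right; apply/orP; right.
  rewrite ler_pdivlMr//; apply: le_trans (mid _ _ _ Apd al_gt0 le_f).
  rewrite /c0 mulrA ler_pM2l ?mulr_gt0// expr2.
  have Mpd : posdefmx (2^-1 *: (A + A0)) by apply: posdefmxZ; [lra|exact: posdefmxD].
  (* Taking both matrices equal to [2^-1 *: A0] turns the midpoint inequality into monotonicity of
     the determinant. *)
  apply: (det_midpoint hA0pd hA0pd _ _).1; first by case: Mpd.
  by move=> x; rewrite !qfZ qfD; have := posdefmx_qf x Apd; lra.
- move=> i; rewrite !le_max; apply/orP; right; apply/orP; left.
  apply: C2P; apply: le_trans (le_f a); rewrite gauss_center ler_pdivrMr//.
  rewrite (le_trans le_de)// ler_pM2l//.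
  have := det_le (A_le _ _ _ Apd al_gt0 le_f le_de).
  by move=> /le_trans; apply; rewrite lerDl.
Qed.

End gaussians_below_bounded.

(** * Existence by compactness *)

Section continuity.
Context {R : realType} {T : topologicalType}.

Lemma continuous_mx m n (F : T -> 'M[R]_(m, n)) :
  (forall i j, continuous (fun p => F p i j)) -> continuous F.
Proof.
move=> Fc p B [P PB sB].
have : \forall q \near p, forall ij : 'I_m * 'I_n, P ij.1 ij.2 (F q ij.1 ij.2).
  by apply: filter_forall => -[i j]; exact: Fc (PB i j).
by apply: filterS => q Pq; apply: sB => i j; exact: Pq (i, j).
Qed.

Lemma continuous_sumr (I : Type) (r : seq I) (F : I -> T -> R) :
  (forall i, continuous (F i)) -> continuous (fun p => \sum_(i <- r) F i p).
Proof. by move=> Fc; apply: continuous_big => //; exact: add_continuous. Qed.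

Lemma continuous_prodr (I : Type) (r : seq I) (F : I -> T -> R) :
  (forall i, continuous (F i)) -> continuous (fun p => \prod_(i <- r) F i p).
Proof. by move=> Fc; apply: continuous_big => //; exact: mul_continuous. Qed.

Lemma continuous_mulr (F G : T -> R) :
  continuous F -> continuous G -> continuous (fun p => F p * G p).
Proof. by move=> Fc Gc p; apply: cvgM; [exact: Fc|exact: Gc]. Qed.

Lemma continuous_addr (F G : T -> R) :
  continuous F -> continuous G -> continuous (fun p => F p + G p).
Proof. by move=> Fc Gc p; apply: (@cvgD _ R^o); [exact: Fc|exact: Gc]. Qed.

Lemma continuous_subr (F G : T -> R) :
  continuous F -> continuous G -> continuous (fun p => F p - G p).
Proof. by move=> Fc Gc p; apply: (@cvgB _ R^o); [exact: Fc|exact: Gc]. Qed.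

Lemma closed_eq0 (F : T -> R) : continuous F -> closed [set p | F p = 0].
Proof.
move=> Fc; apply: (@preimage_closed _ _ F [set 0]); first by move=> p _; exact: Fc.
exact: closed_eq.
Qed.

Lemma closed_ge0 (F : T -> R) : continuous F -> closed [set p | 0 <= F p].
Proof.
move=> Fc; apply: (@preimage_closed _ _ F [set t | 0 <= t]).
  by move=> p _; exact: Fc.
exact: closed_ge.
Qed.

Lemma continuous_mulmx m n k (F : T -> 'M[R]_(m, n)) (B : 'M[R]_(n, k)) :
  (forall i j, continuous (fun p => F p i j)) ->
  forall i j, continuous (fun p => (F p *m B) i j).
Proof.
move=> Fc i j; under eq_fun do rewrite mxE.
by apply: continuous_sumr => l; apply: continuous_mulr => //; exact: cst_continuous.
Qed.

Lemma continuous_det n (F : T -> 'M[R]_n) :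
  (forall i j, continuous (fun p => F p i j)) -> continuous (fun p => \det (F p)).
Proof.
move=> Fc; apply: continuous_sumr => s; apply: continuous_mulr.
  exact: cst_continuous.
by apply: continuous_prodr => i.
Qed.

Lemma continuous_qf n (F : T -> 'M[R]_n) x :
  (forall i j, continuous (fun p => F p i j)) -> continuous (fun p => qf (F p) x).
Proof.
move=> Fc; apply: continuous_sumr => i; apply: continuous_mulr.
  exact: cst_continuous.
exact: continuous_mulmx.
Qed.

Lemma closed_usc_le d (f : 'cV[R]_d -> R) (y : T -> 'cV[R]_d) (h : T -> R) :
  upper_semicontinuous f -> continuous y -> continuous h ->
  closed [set p | h p <= f (y p)].
Proof.
move=> usc yc hc; rewrite -openC openE => p /= /negP; rewrite -ltNge => lt_fh.
(* A level strictly between the two values: near [p], upper semicontinuity keeps [f] below it and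
   continuity keeps [h] above it. *)
pose r := (f (y p) + h p) / 2.
have [|V Vy Vr] := usc (y p) (- r); first by rewrite lte_fin /r; lra.
have nV : \forall q \near p, V (y q) by exact: yc.
have nh : \forall q \near p, r < h q.
  by apply: (cvgr_gt (h p) (hc p)); rewrite /r; lra.
near=> q => /=; apply/negP; rewrite -ltNge.
have : r < h q by near: q.
have /Vr : V (y q) by near: q.
by rewrite lte_fin ltrN2; exact: lt_trans.
Unshelve. all: by end_near. Qed.

End continuity.

(** * The compact parameter set and a maximizer *)

Section existence.
Context {R : realType} {d : nat}.
Implicit Types (f : 'cV[R]_d -> R) (A : 'M[R]_d) (al : R) (a : 'cV[R]_d).

(** One row vector stores the entries of the matrix, the height and the center, so that [rV_compact]
    gives compactness of boxes. *)
Definition params := 'rV[R]_(d * d + (1 + d)).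

Definition params_mx (p : params) : 'M[R]_d := vec_mx (lsubmx p).
Definition params_height (p : params) : R := rsubmx p 0 (lshift d 0).
Definition params_center (p : params) : 'cV[R]_d := (rsubmx (rsubmx p))^T.

Definition mk_params A al a : params :=
  row_mx (mxvec A) (row_mx (const_mx al) a^T).

Lemma mk_paramsK A al a : [/\ params_mx (mk_params A al a) = A,
  params_height (mk_params A al a) = al &
  params_center (mk_params A al a) = a].
Proof.
rewrite /params_mx /params_height /params_center !row_mxKl !row_mxKr mxvecK trmxK.
by rewrite row_mxEl mxE.
Qed.

Lemma mk_params_le A al a (C : R) :
  (forall i j, `|A i j| <= C) -> `|al| <= C -> (forall i, `|a i 0| <= C) ->
  forall k, `|mk_params A al a ord0 k| <= C.
Proof.
move=> AC alC aC k; rewrite -[k]splitK; case: (fintype.split k) => [l|l] /=.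
  by rewrite row_mxEl; case/mxvec_indexP: l => i j; rewrite mxvecE.
rewrite row_mxEr -[l]splitK; case: (fintype.split l) => [l'|l'] /=.
  by rewrite row_mxEl mxE.
by rewrite row_mxEr mxE.
Qed.

Lemma continuous_params_mx i j : continuous (fun p => params_mx p i j).
Proof.
under eq_fun do rewrite !mxE; exact: coord_continuous.
Qed.

Lemma continuous_params_height : continuous params_height.
Proof.
rewrite /params_height; under eq_fun do rewrite !mxE; exact: coord_continuous.
Qed.

Lemma continuous_params_center i j : continuous (fun p => params_center p i j).
Proof.
under eq_fun do rewrite !mxE; exact: coord_continuous.
Qed.

(** A closed relaxation: the matrix may be singular and the height zero. Domination is stated in the
    form of [gauss_belowP], which still makes sense for a singular matrix. *)
Definition admissible f : set params := [set p | [/\ (params_mx p)^T = params_mx p,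
  forall x, 0 <= qf (params_mx p) x, 0 <= params_height p &
  forall u, params_height p * expR (- dotv u u) <=
    f (params_center p + params_mx p *m u)]].

Lemma closed_admissible f : upper_semicontinuous f -> closed (admissible f).
Proof.
move=> usc.
have -> : admissible f =
    \bigcap_(ij in [set: 'I_d * 'I_d])
      [set p | params_mx p ij.1 ij.2 - params_mx p ij.2 ij.1 = 0] `&`
    \bigcap_(x in [set: 'cV[R]_d]) [set p | 0 <= qf (params_mx p) x] `&`
    [set p | 0 <= params_height p] `&`
    \bigcap_(u in [set: 'cV[R]_d]) [set p |
      params_height p * expR (- dotv u u) <=
        f (params_center p + params_mx p *m u)].
  apply/seteqP; split => [p [ps p0 ph pf]|p [[[ps p0] ph] pf]].
    split; last by move=> u _; exact: pf.
    split=> //; split; last by move=> x _; exact: p0.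
    by move=> [i j] _ /=; rewrite -[in X in X - _]ps mxE subrr.
  split => //.
  - apply/matrixP => i j; rewrite mxE; apply/eqP; rewrite -subr_eq0; apply/eqP.
    exact: ps (j, i) Logic.I.
  - by move=> x; exact: p0 x Logic.I.
  - by move=> u; exact: pf u Logic.I.
have mxc := continuous_params_mx.
apply: closedI; first apply: closedI; first apply: closedI.
- by apply: closed_bigI => -[i j] _ /=; apply: closed_eq0; exact: continuous_subr.
- by apply: closed_bigI => x _; apply: closed_ge0; exact: continuous_qf.
- exact/closed_ge0/continuous_params_height.
- apply: closed_bigI => u _; apply: closed_usc_le => //.
  + apply: continuous_mx => i j; under eq_fun do rewrite mxE.
    apply: continuous_addr; first exact: continuous_params_center.
    exact: continuous_mulmx.
  + apply: continuous_mulr; first exact: continuous_params_height.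
    exact: cst_continuous.
Qed.

Lemma exists_max_gaussian f : log_concave f -> upper_semicontinuous f ->
  (forall x, 0 < f x) -> (integral_cV f < +oo)%E ->
  (exists g, gaussian_below f g) -> exists g, max_gaussian_below f g.
Proof.
move=> lcf usc f0 foo [g0 /gaussian_belowE[A0 [al0 [a0 [A0pd al00 _ le_f0]]]]].
have [C CP] := gauss_params_bounded lcf f0 foo A0pd al00 le_f0.
pose K := admissible f `&` [set p : params | forall k, `[- C, C]%classic (p ord0 k)].
pose value p := params_height p * \det (params_mx p).
(* The bound [C] covers only Gaussians whose value is at least that of the reference one. *)
have K_gauss A al a : posdefmx A -> 0 < al -> (forall x, gauss A al a x <= f x) ->
    al0 * \det A0 <= al * \det A ->
    K (mk_params A al a) /\ value (mk_params A al a) = al * \det A.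
  move=> Apd al_gt0 le_f le_v; have [AC alC aC] := CP _ _ _ Apd al_gt0 le_f le_v.
  rewrite /value; have [-> -> _] := mk_paramsK A al a; split=> //; split.
    rewrite /admissible/=; have [-> -> ->] := mk_paramsK A al a; split.
    - by case: Apd.
    - by move=> x; exact: posdefmx_qf.
    - exact: ltW.
    - exact: (gauss_belowP _ _ _ (posdefmx_unit Apd)).1.
  move=> k /=; rewrite in_itv/= -ler_norml; apply: mk_params_le => //.
  by rewrite gtr0_norm.
have Kc : compact K.
  have cb : compact [set p : params | forall k, `[- C, C]%classic (p ord0 k)].
    by apply: (@rV_compact _ _ (fun=> `[- C, C]%classic)) => _; exact: segment_compact.
  apply: (subclosed_compact _ cb); last by move=> p [].
  apply: closedI; first exact: closed_admissible.
  apply: compact_closed cb; exact: norm_hausdorff.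
have [Kp0 vp0] := K_gauss A0 al0 a0 A0pd al00 le_f0 (lexx _).
have vc : continuous value.
  apply: continuous_mulr; first exact: continuous_params_height.
  by apply: continuous_det; exact: continuous_params_mx.
have [|p pK p_max] := compact_EVT_max (ex_intro _ _ Kp0) Kc (f := value).
  exact: continuous_subspaceT.
have {}p_max q : K q -> value q <= value p by move=> Kq; apply: p_max; exact/mem_set.
move/set_mem: pK => [[ps p0 ph pf] _].
(* The maximum is at least the positive reference value. This rules out zero height and a singular
   matrix, so the maximizer is a genuine Gaussian. *)
have v0 : 0 < value p.
  apply: lt_le_trans (p_max _ Kp0); rewrite vp0 mulr_gt0//; exact: posdefmx_det.
have h0 : 0 < params_height p.
  rewrite lt_neqAle ph andbT; apply/eqP => h0.
  by move: v0; rewrite /value -h0 mul0r ltxx.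
have d0 : 0 < \det (params_mx p) by move: v0; rewrite /value pmulr_rgt0.
have ppd : posdefmx (params_mx p).
  by apply: psd_unit_posdefmx => //; rewrite unitmxE unitfE gt_eqF.
exists (gauss (params_mx p) (params_height p) (params_center p)); split.
  by apply: gauss_below => //; exact: (gauss_belowP _ _ _ (posdefmx_unit ppd)).2.
move=> h /gaussian_belowE[A [al [a [Apd al_gt0 -> le_f]]]].
rewrite !integral_gauss// lee_fin ler_pM2l ?exprn_gt0 ?sqrtr_gt0 ?pi_gt0//.
(* A competitor below the reference value may lie outside [K], but it is beaten by the reference
   Gaussian. *)
have [le_v|lt_v] := leP (al0 * \det A0) (al * \det A).
  by have [Kq <-] := K_gauss A al a Apd al_gt0 le_f le_v; exact: p_max.
by apply: (le_trans (ltW lt_v)); rewrite -vp0; exact: p_max.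
Qed.

End existence.

Theorem theorem7p1 (R : realType) (d : nat) (f : 'cV[R]_d -> R)
    (f_proper : proper_log_concave f)
    (f_below : exists g : 'cV[R]_d -> R, gaussian_below f g) :
  (exists g : 'cV[R]_d -> R, max_gaussian_below f g) /\
  (forall g h : 'cV[R]_d -> R,
    max_gaussian_below f g -> max_gaussian_below f h -> translate_of g h).
Proof.
have [lcf usc /andP[_ foo]] := f_proper.
(* The Gaussian below [f] makes it positive everywhere, so logarithms of [f] are available
   throughout. *)
have f0 x : 0 < f x.
  have [g0 /gaussian_belowE[A0 [al0 [a0 [_ al00 _ le_f0]]]]] := f_below.
  by apply: lt_le_trans (le_f0 x); exact: gauss_gt0.
split; first exact: exists_max_gaussian.
by move=> g h; exact: max_gauss_translate.
Qed.
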